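(* Let $\mathbb{F}$ be a field of characteristic different from $2$ and $n,m\ge1$ integers. The Rost multipliers of the lifted Kronecker tensor product map $\phi_{\mathbf{Sp}}\colon\mathbf{Sp}_{2n}\times\mathbf{Sp}_{2m}\to\mathbf{Spin}_{4nm}$ are $(m,n)$. That is, $$\phi_{\mathbf{Sp}}^\dagger(q_{\mathbf{Spin}_{4nm}})=(m\,q_{\mathbf{Sp}_{2n}},\,n\,q_{\mathbf{Sp}_{2m}}).$$
   Context: Groups (all split over $\mathbb{F}$). $\Omega_r$ is the $r\times r$ antidiagonal matrix of ones, $\Psi_{2r}=\begin{bmatrix}0&\Omega_r\\-\Omega_r&0\end{bmatrix}$. $\mathbf{SO}_r=\{A: A\,\Omega_rA^T\Omega_r=I,\ \det A=1\}$; $\mathbf{Spin}_r\twoheadrightarrow\mathbf{SO}_r$ its spin double cover; $\mathbf{Sp}_{2r}=\{A: A(-\Psi_{2r}A^T\Psi_{2r})=I\}$. Map. $\rho_{\mathbf{Sp}}\colon\mathbf{Sp}_{2n}\times\mathbf{Sp}_{2m}\to\mathbf{SO}_{4nm}$ is $(A,B)\mapsto P^{-1}(A\otimes B)P$ (Kronecker product), where $P$ is block diagonal with $n$ blocks $J=\mathrm{diag}(I_m,-\Omega_m)$ followed by $n$ blocks $K=\mathrm{diag}(\Omega_m,I_m)$. $\phi_{\mathbf{Sp}}$ is the unique homomorphism $\mathbf{Sp}_{2n}\times\mathbf{Sp}_{2m}\to\mathbf{Spin}_{4nm}$ whose composition with $\mathbf{Spin}_{4nm}\twoheadrightarrow\mathbf{SO}_{4nm}$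 is $\rho_{\mathbf{Sp}}$. Rost multipliers. For a split semisimple group $G$ with split maximal torus $T_G$, character lattice $T_G^*$ and Weyl group $W_G$, consider $S^2(T_G^* )^{W_G}$, the $W_G$-invariants of the second symmetric power; for simple $G$ it is infinite cyclic, generated by the normalized Killing form $q_G$, and for a product it is the direct sum of the groups of the factors. A homomorphism $\varphi\colon G\to H$ (taking $T_G$ into $T_H$) induces $\varphi^*\colon T_H^*\to T_G^*$ and $\varphi^\dagger\colon S^2(T_H^* )^{W_H}\to S^2(T_G^* )^{W_G}$; the coefficients of the image of $q_H$ in terms of the normalized Killing forms of the factors of $G$ are the Rost multipliers. The tori are (the preimages of) the diagonal tori $\mathrm{diag}(s_1,\dots,s_r,s_r^{-1},\dots,s_1^{-1})$ of $\mathbf{Sp}_{2r}$, $\mathbf{SO}_{2r}$, with $e_i\mapsto s_i$; character lattices are viewed in $\bigoplus\mathbb{Q}e_i$. The normalized Killing forms are $q_{\mathbf{Sp}_{2r}}=\sum_{i=1}^re_i^2$ and $q_{\mathbf{Spin}_{2r}}=\tfrac12\sum_{i=1}^re_i^2$ (for $\mathbf{Spin}_4$, which is not simple, this formula is taken as the definition). *)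

(* Defs.v *)
From Stdlib Require Import ClassicalEpsilon.
From mathcomp Require Import all_boot all_order all_algebra.
From mathcomp Require Import mxtens mpoly.

Set Implicit Arguments.
Unset Strict Implicit.
Unset Printing Implicit Defensive.

Import GRing.Theory.
Local Open Scope ring_scope.

(* Algebraic groups over F are given by their functors of points on            *)
(* commutative F-algebras R.  G(R) is the set of [mem]bers of an ambient type, *)
(* taken modulo [eqv]; [eqv] is Leibniz equality for matrix groups and is      *)
(* needed only for Spin, whose points are represented by elements of a tensor  *)
(* algebra.  The group axioms are not fields: only explicit groups are used.   *)
(* The comUnitAlgType structure only adds a classical unit test to R and       *)
(* excludes the zero algebra.                                                  *)
Record gfunctor (F : fieldType) := GFunctor {
  amb : comUnitAlgType F -> Type;
  mem : forall R, amb R -> Prop;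
  eqv : forall R, amb R -> amb R -> Prop;
  gmul : forall R, amb R -> amb R -> amb R;
  bchange : forall R S : comUnitAlgType F, {lrmorphism R -> S} -> amb R -> amb S
}.

(* By Yoneda, natural homomorphisms of representable group functors are the    *)
(* homomorphisms of algebraic groups.  Values outside G(R) are irrelevant.     *)
Record ghom (F : fieldType) (G H : gfunctor F) := GHom {
  happ :> forall R : comUnitAlgType F, amb G R -> amb H R;
  happ_mem : forall R (x : amb G R), mem x -> mem (happ x);
  happ_eqv : forall R (x y : amb G R), mem x -> mem y -> eqv x y ->
    eqv (happ x) (happ y);
  happ_mul : forall R (x y : amb G R), mem x -> mem y ->
    eqv (happ (gmul x y)) (gmul (happ x) (happ y));
  happ_nat : forall (R S : comUnitAlgType F) (f : {lrmorphism R -> S})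
    (x : amb G R), mem x -> eqv (happ (bchange f x)) (bchange f (happ x))
}.

(* A group with a split maximal torus T and characters e_1, ..., e_r of T      *)
(* forming a basis of the rational character space of T.  [charf] is only      *)
(* meaningful on points of T, where its values are units.                      *)
Record split_group (F : fieldType) := SplitGroup {
  sgrp :> gfunctor F;
  torus : forall R : comUnitAlgType F, amb sgrp R -> Prop;
  rank : nat;
  charf : 'I_rank -> forall R : comUnitAlgType F, amb sgrp R -> R
}.

Section MatrixGroups.

Variable F : fieldType.

Definition Omega (R : pzRingType) (N : nat) : 'M[R]_N :=
  \matrix_(i, j) ((i + j).+1 == N)%:R.

Definition Psi (R : pzRingType) (r : nat) : 'M[R]_(r + r) :=
  block_mx 0 (Omega R r) (- Omega R r) 0.

Definition isSp (R : comUnitAlgType F) (r : nat) (A : 'M[R]_(r + r)) : Prop :=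
  A *m (- (Psi R r *m A^T *m Psi R r)) = 1%:M.

Definition isSO (R : comUnitAlgType F) (N : nat) (A : 'M[R]_N) : Prop :=
  A *m Omega R N *m A^T *m Omega R N = 1%:M /\ \det A = 1.

Definition SpF (r : nat) : gfunctor F :=
  @GFunctor F (fun R => 'M[R]_(r + r)) (fun R => @isSp R r) (fun R => eq)
    (fun R => mulmx) (fun R S f => map_mx f).

(* A diagonal matrix of Sp_2r is automatically of the form                     *)
(* diag(s_1, ..., s_r, s_r^-1, ..., s_1^-1); likewise for SO_2r below.         *)
Definition Sp (r : nat) : split_group F :=
  @SplitGroup F (SpF r) (fun R A => isSp A /\ is_diag_mx A) r
    (fun i R A => A (lshift r i) (lshift r i)).

End MatrixGroups.

(* Elements of the tensor algebra of R^N.                                      *)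
Inductive tens (R : Type) (N : nat) :=
  | TScal of R
  | TVec of 'cV[R]_N
  | TAdd of tens R N & tens R N
  | TMul of tens R N & tens R N.

Section Clifford.

Variables (R : comUnitRingType) (N : nat).
Implicit Types x y : tens R N.

Definition qform (v : 'cV[R]_N) : R := (v^T *m Omega R N *m v) 0 0.

Fixpoint tens_eval (C : algType R) (g : 'cV[R]_N -> C) x : C :=
  match x with
  | TScal c => c%:A
  | TVec v => g v
  | TAdd y z => tens_eval g y + tens_eval g z
  | TMul y z => tens_eval g y * tens_eval g z
  end.

(* Equality in the Clifford algebra Cl of (R^N, qform), the tensor algebra     *)
(* modulo the v (x) v - qform v: by the universal property of Cl two tensors   *)
(* have the same image in Cl iff they agree under every Clifford map.          *)
Definition cl_eq x y : Prop :=
  forall (C : algType R) (g : {linear 'cV[R]_N -> C}),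
    (forall v, g v * g v = (qform v)%:A) -> tens_eval g x = tens_eval g y.

(* [tens_par b x]: x is visibly a sum of products of an even (b = false) or    *)
(* odd (b = true) number of vectors.                                           *)
Fixpoint tens_par (b : bool) x : bool :=
  match x with
  | TScal _ => ~~ b
  | TVec _ => b
  | TAdd y z => tens_par b y && tens_par b z
  | TMul y z => (tens_par false y && tens_par b z)
                || (tens_par true y && tens_par (~~ b) z)
  end.

Definition cl_even x : Prop := exists2 y, tens_par false y & cl_eq x y.

(* The canonical involution of Cl, which is the identity on vectors.           *)
Fixpoint tens_rev x : tens R N :=
  match x with
  | TAdd y z => TAdd (tens_rev y) (tens_rev z)
  | TMul y z => TMul (tens_rev z) (tens_rev y)
  | _ => x
  end.

End Clifford.

Fixpoint tens_map (R S : Type) (N : nat) (f : R -> S) (x : tens R N) : tens S N :=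
  match x with
  | TScal c => TScal N (f c)
  | TVec v => TVec (map_mx f v)
  | TAdd y z => TAdd (tens_map f y) (tens_map f z)
  | TMul y z => TMul (tens_map f y) (tens_map f z)
  end.

Lemma half_le (N : nat) : (N./2 <= N)%N.
Proof. by rewrite leq_half_double -addnn leqW // leq_addr. Qed.

Section Spin.

Variables (F : fieldType) (N : nat).

(* Spin_N(R) is the set of even g in Cl with g * rev g = 1 and g V g^-1 = V.   *)
(* Its vector representation g |-> (v |-> g v g^-1), which is determined by g, *)
(* is recorded in the first component A, so that the double cover              *)
(* Spin_N -> SO_N is the first projection.                                     *)
Definition isSpin (R : comUnitAlgType F) (p : 'M[R]_N * tens R N) : Prop :=
  let: (A, g) := p in
  [/\ isSO A,
      cl_even g,
      cl_eq (TMul g (tens_rev g)) (TScal N 1),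
      cl_eq (TMul (tens_rev g) g) (TScal N 1)
    & forall v : 'cV[R]_N,
        cl_eq (TMul (TMul g (TVec v)) (tens_rev g)) (TVec (A *m v))].

Definition SpinF : gfunctor F :=
  @GFunctor F (fun R => ('M[R]_N * tens R N)%type) isSpin
    (fun R p q => p.1 = q.1 /\ cl_eq p.2 q.2)
    (fun R p q => (p.1 *m q.1, TMul p.2 q.2))
    (fun R S f p => (map_mx f p.1, tens_map f p.2)).

Definition spin_cover (R : comUnitAlgType F) (p : amb SpinF R) : 'M[R]_N := p.1.

(* For N = 2r the torus is the preimage of the diagonal torus of SO_2r.        *)
Definition Spin : split_group F :=
  @SplitGroup F SpinF (fun R p => isSpin p /\ is_diag_mx (spin_cover p)) N./2
    (fun i R p => let j := widen_ord (half_le N) i in spin_cover p j j).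

End Spin.

Section Products.

Variable F : fieldType.

Definition prodF (G H : gfunctor F) : gfunctor F :=
  @GFunctor F (fun R => (amb G R * amb H R)%type)
    (fun R p => mem p.1 /\ mem p.2)
    (fun R p q => eqv p.1 q.1 /\ eqv p.2 q.2)
    (fun R p q => (gmul p.1 q.1, gmul p.2 q.2))
    (fun R S f p => (bchange f p.1, bchange f p.2)).

Definition sprod (G H : split_group F) : split_group F :=
  @SplitGroup F (prodF G H) (fun R p => torus p.1 /\ torus p.2)
    (rank G + rank H)
    (fun i R p => match split i with
                  | inl j => charf j p.1
                  | inr j => charf j p.2
                  end).

End Products.

(* The second symmetric power of the rational character space (+) Q e_i is the *)
(* space of quadratic forms in the e_i, with e_i written 'X_i.  It contains    *)
(* S^2(T^* ) and its Weyl group invariants.                                    *)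
Section RostMultipliers.

Variable F : fieldType.

(* The character chi of the torus of G is the vector v of (+) Q e_i: for some  *)
(* k > 0 the vector a = k v is integral and chi^k = \prod_i e_i^(a_i).         *)
Definition has_coords (G : split_group F)
    (chi : forall R : comUnitAlgType F, amb G R -> R) (v : 'rV[rat]_(rank G)) :=
  exists (k : nat) (a : 'I_(rank G) -> int),
    [/\ (0 < k)%N,
        forall i, v 0 i *+ k = (a i)%:~R
      & forall (R : comUnitAlgType F) (t : amb G R), torus t ->
          chi R t ^+ k = \prod_i charf i t ^ a i].

Definition coords (G : split_group F)
    (chi : forall R : comUnitAlgType F, amb G R -> R) : 'rV[rat]_(rank G) :=
  epsilon (inhabits 0) (has_coords chi).

(* phi^* *)
Definition pullback (G H : gfunctor F) (phi : ghom G H)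
    (chi : forall R : comUnitAlgType F, amb H R -> R) :
    forall R : comUnitAlgType F, amb G R -> R :=
  fun R x => chi R (phi R x).

Definition linform (r : nat) (v : 'rV[rat]_r) : {mpoly rat[r]} :=
  \sum_i v 0 i *: 'X_i.

(* phi^dagger = S^2(phi^* ), on the whole of S^2((+) Q e_i).                   *)
Definition dagger (G H : split_group F) (phi : ghom G H)
    (q : {mpoly rat[rank H]}) : {mpoly rat[rank G]} :=
  comp_mpoly [tuple linform (coords (pullback phi (charf i))) | i < rank H] q.

(* The embedding of S^2(T_G^* ) (+) S^2(T_H^* ) into S^2(T_(G x H)^* ).        *)
Definition S2pair (G H : split_group F)
    (q : {mpoly rat[rank G]} * {mpoly rat[rank H]}) :
    {mpoly rat[rank (sprod G H)]} :=
  comp_mpoly [tuple 'X_(lshift (rank H) i) | i < rank G] q.1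
  + comp_mpoly [tuple 'X_(rshift (rank G) i) | i < rank H] q.2.

Definition q_Sp (r : nat) : {mpoly rat[rank (Sp F r)]} := \sum_i 'X_i ^+ 2.

Definition q_Spin (N : nat) : {mpoly rat[rank (Spin F N)]} :=
  2%:R^-1 *: \sum_i 'X_i ^+ 2.

End RostMultipliers.

Section KroneckerMap.

Variables (F : fieldType) (n m : nat) (R : comUnitAlgType F).

Definition Jmx : 'M[R]_(m + m) := block_mx 1%:M 0 0 (- Omega R m).
Definition Kmx : 'M[R]_(m + m) := block_mx (Omega R m) 0 0 1%:M.

(* Block diagonal: n blocks J followed by n blocks K.                          *)
Definition Pmx : 'M[R]_((n + n) * (m + m)) :=
  block_mx 1%:M 0 0 0 *t Jmx + block_mx 0 0 0 1%:M *t Kmx.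

Definition rho_Sp (x : amb (sprod (Sp F n) (Sp F m)) R) :
    'M[R]_((n + n) * (m + m)) :=
  invmx Pmx *m (x.1 *t x.2) *m Pmx.

End KroneckerMap.

(* phi : Sp_2n x Sp_2m -> Spin_4nm lifts rho_Sp; there is exactly one such phi.*)
Definition is_phi_Sp (F : fieldType) (n m : nat)
    (phi : ghom (sprod (Sp F n) (Sp F m)) (Spin F ((n + n) * (m + m)))) : Prop :=
  forall (R : comUnitAlgType F) (x : amb (sprod (Sp F n) (Sp F m)) R),
    mem x -> spin_cover (phi R x) = rho_Sp x.

(* Main.v *)
Require Import Defs.
From mathcomp Require Import all_boot all_order all_algebra.
From mathcomp Require Import mpoly.
From Stdlib Require Import ClassicalEpsilon.
From HB Require Import structures.
From mathcomp Require Import mxtens ring.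

(* Conjugation by P sends the first 2nm coordinates of the torus of SO_4nm,
   indexed by pairs (a, b), to e_a + f_b and e_a - f_b, where e and f are the
   torus characters of Sp_2n and Sp_2m.  The cross terms of the squares cancel:
   (1/2) \sum ((e_a + f_b)^2 + (e_a - f_b)^2) = m \sum e_a^2 + n \sum f_b^2. *)

Set Implicit Arguments.
Unset Strict Implicit.
Unset Printing Implicit Defensive.

Import GRing.Theory.
Local Open Scope ring_scope.

(* F may be finite, so separating torus characters needs an F-algebra with a
   unit of infinite order: the field F(X). *)
Definition ratfun (F : fieldType) : Type := {fraction {poly F}}.

(** * The rational function field as an algebra over [F] *)

Section RatfunAlgebra.

Variable F : fieldType.

Definition ratfun_C (c : F) : ratfun F := FracField.tofrac c%:P.
Definition ratfun_X : ratfun F := FracField.tofrac 'X.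

HB.instance Definition _ := GRing.Field.on (ratfun F).

Let ratfun_scale (c : F) (x : ratfun F) : ratfun F := ratfun_C c * x.

Fact ratfun_scalerA a b x :
  ratfun_scale a (ratfun_scale b x) = ratfun_scale (a * b) x.
Proof. by rewrite /ratfun_scale /ratfun_C polyCM tofracM mulrA. Qed.

Fact ratfun_scale1r : left_id 1 ratfun_scale.
Proof. by move=> x; rewrite /ratfun_scale /ratfun_C tofrac1 mul1r. Qed.

Fact ratfun_scalerDr : right_distributive ratfun_scale +%R.
Proof. by move=> c x y; rewrite /ratfun_scale mulrDr. Qed.

Fact ratfun_scalerDl x : {morph ratfun_scale^~ x : a b / a + b}.
Proof. by move=> a b; rewrite /ratfun_scale /ratfun_C polyCD tofracD mulrDl. Qed.

HB.instance Definition _ := GRing.Zmodule_isLmodule.Build F (ratfun F)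
  ratfun_scalerA ratfun_scale1r ratfun_scalerDr ratfun_scalerDl.

Fact ratfun_scalerAl (c : F) (x y : ratfun F) : c *: (x * y) = (c *: x) * y.
Proof. by rewrite /GRing.scale /= /ratfun_scale mulrA. Qed.

HB.instance Definition _ :=
  GRing.Lmodule_isLalgebra.Build F (ratfun F) ratfun_scalerAl.
HB.instance Definition _ := GRing.Lalgebra_isComAlgebra.Build F (ratfun F).

Definition ratfun_alg : comUnitAlgType F := ratfun F.

Lemma ratfun_X_unit : (ratfun_X : ratfun_alg) \is a GRing.unit.
Proof. by rewrite unitfE tofrac_eq0 polyX_eq0. Qed.

Lemma ratfun_Xn_eq1 (k : nat) : ((ratfun_X : ratfun_alg) ^+ k == 1) = (k == 0%N).
Proof.
rewrite -tofracXn -tofrac1 tofrac_eq; apply/eqP/eqP => [|->]; last by rewrite expr0.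
by move/(congr1 (fun p : {poly F} => size p)); rewrite size_polyXn size_poly1 => -[].
Qed.

(** Equal powers give a trivial power with the difference as exponent; a negative difference is
    inverted first, and then comparing degrees forces it to be zero. *)
Lemma ratfun_Xz_inj : injective (exprz (ratfun_X : ratfun_alg)).
Proof.
move=> a b eq_ab; apply/eqP; rewrite -subr_eq0.
have: (ratfun_X : ratfun_alg) ^ (a - b) == 1.
  by rewrite expfzDr ?tofrac_eq0 ?polyX_eq0 // eq_ab -expfzDr
    ?tofrac_eq0 ?polyX_eq0 // subrr expr0z.
case: (a - b) => k; first by rewrite -exprnP ratfun_Xn_eq1.
by rewrite NegzE -exprnN invr_eq1 ratfun_Xn_eq1.
Qed.

End RatfunAlgebra.

(** * The antidiagonal matrix and the diagonal torus of the symplectic group *)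

Section Torus.

Variables (F : fieldType) (R : comUnitAlgType F).

Lemma mulOmegamx (r p : nat) (M : 'M[R]_(r, p)) i j :
  (Omega R r *m M) i j = M (rev_ord i) j.
Proof.
rewrite mxE (bigD1 (rev_ord i)) //= big1 => [|k ne_k]; last first.
  rewrite mxE [_ == _](_ : _ = false) ?mul0r //; apply: contraNF ne_k => /eqP eqr.
  by apply/eqP/val_inj; rewrite /= -[X in (X - _)%N]eqr -addSn addKn.
by rewrite mxE /= -addSn subnKC // eqxx mul1r addr0.
Qed.

Lemma mulmxOmega (r p : nat) (M : 'M[R]_(p, r)) i j :
  (M *m Omega R r) i j = M i (rev_ord j).
Proof.
have OmegaT : (Omega R r)^T = Omega R r.
  by apply/matrixP => k l; rewrite !mxE addnC.
(* The entry is recast as an entry of the transpose, which moves the symmetric matrix [Omega] to the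
   left. *)
by rewrite -[LHS](mxE trmx_key (fun j i => (M *m Omega R r) i j)) -/(trmx _)
  trmx_mul OmegaT mulOmegamx mxE.
Qed.

Lemma Omega_mulmx_Omega (r : nat) (M : 'M[R]_r) i j :
  (Omega R r *m M *m Omega R r) i j = M (rev_ord i) (rev_ord j).
Proof. by rewrite mulmxOmega mulOmegamx. Qed.

Lemma Omega_sqr (r : nat) : Omega R r *m Omega R r = 1%:M.
Proof.
apply/matrixP => i j; rewrite mulOmegamx !mxE -val_eqE /= -addnS.
by rewrite -[X in _ == X](subnK (ltn_ord i)) eqn_add2l eqSS eq_sym.
Qed.

(** The off-diagonal blocks of [Psi] swap [D] and [E], and their opposite signs cancel the outer
    minus sign of [isSp]. *)
Lemma isSp_block_diag (r : nat) (D E : 'M[R]_r) :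
  isSp (block_mx D 0 0 E) <->
  D *m (Omega R r *m E^T *m Omega R r) = 1%:M
  /\ E *m (Omega R r *m D^T *m Omega R r) = 1%:M.
Proof.
rewrite /isSp /Psi tr_block_mx !trmx0 !mulmx_block !(mulmx0, mul0mx, add0r, addr0).
rewrite mulmxN mulmx_block !(mulmx0, mul0mx, add0r, addr0) opp_block_mx !oppr0.
rewrite !(mulmxN, mulNmx) !opprK (scalar_mx_block r r 1).
by split=> [/eq_block_mx[-> _ _ ->]|[-> ->]].
Qed.

Lemma is_diag_block (r : nat) (A : 'M[R]_(r + r)) : is_diag_mx A ->
  exists d e : 'rV[R]_r, A = block_mx (diag_mx d) 0 0 (diag_mx e).
Proof.
rewrite -{1}[A]submxK is_diag_block_mx // => /and4P[/eqP ur0 /eqP dl0].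
move=> /diag_mxP[d ul] /diag_mxP[e dr].
by exists d, e; rewrite -[A]submxK ur0 dl0 ul dr.
Qed.

(** The reversed indices in the lower half give the order [s_r^-1, ..., s_1^-1]. *)
Definition torus_mx (r : nat) (d : 'rV[R]_r) : 'M[R]_(r + r) :=
  block_mx (diag_mx d) 0 0 (diag_mx (\row_j (d 0 (rev_ord j))^-1)).

Lemma torus_mx_torus (r : nat) (d : 'rV[R]_r) :
  (forall i, d 0 i \is a GRing.unit) -> torus (torus_mx d : amb (Sp F r) R).
Proof.
move=> d_unit; split; last first.
  by rewrite is_diag_block_mx // !eqxx !diag_mx_is_diag.
apply/isSp_block_diag; split; apply/matrixP => i j; rewrite mul_diag_mx mxE
  Omega_mulmx_Omega tr_diag_mx !mxE (inj_eq rev_ord_inj).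
  by rewrite rev_ordK; case: eqVneq => [->|]; rewrite ?mulr0 // mulrV.
by case: eqVneq => [->|]; rewrite ?mulr0 // mulVr.
Qed.

Lemma torusP (r : nat) (A : amb (Sp F r) R) : torus A ->
  exists d : 'rV[R]_r, A = torus_mx d.
Proof.
case=> spA /is_diag_block[d [e defA]]; exists d.
rewrite defA; congr block_mx; congr diag_mx; apply/rowP => j; rewrite mxE.
(* The second block equation at [(j, j)] makes [e 0 j] inverse to [d 0 (rev_ord j)]. *)
move: spA; rewrite defA => /isSp_block_diag[_ /matrixP/(_ j j)].
rewrite mul_diag_mx mxE Omega_mulmx_Omega tr_diag_mx !mxE !eqxx !mulr1n => ed1.
have d_unit: d 0 (rev_ord j) \is a GRing.unit.
  by apply/unitrPr; exists (e 0 j); rewrite mulrC.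
by apply: (mulIr d_unit); rewrite mulVr.
Qed.

(** * The map [rho_Sp] on pairs of torus elements *)

Section KroneckerDiagonal.

Variables n m : nat.

Lemma Jmx_sqr : Jmx m R *m Jmx m R = 1%:M.
Proof.
by rewrite mulmx_block !(mulmx0, mul0mx, add0r, addr0) mul1mx mulmxN mulNmx
  opprK Omega_sqr -scalar_mx_block.
Qed.

Lemma Kmx_sqr : Kmx m R *m Kmx m R = 1%:M.
Proof.
by rewrite mulmx_block !(mulmx0, mul0mx, add0r, addr0) mul1mx
  Omega_sqr -scalar_mx_block.
Qed.

(** The involutions [Jmx] and [Kmx] sit on complementary blocks, so the cross terms of the square of
    [Pmx] vanish and the square is the identity. *)
Lemma invmx_Pmx : invmx (Pmx n m R) = Pmx n m R.
Proof.
have PP : Pmx n m R *m Pmx n m R = 1%:M.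
  rewrite mulmxDl !mulmxDr !tensmx_mul Jmx_sqr Kmx_sqr !mulmx_block.
  rewrite !(mulmx0, mul0mx, add0r, addr0, mul1mx) block_mx0.
  rewrite !tens0mx addr0 add0r; apply/matrixP => i j.
  case: (mxtens_indexP i) => i1 i2; case: (mxtens_indexP j) => j1 j2.
  rewrite mxE !tensmxE -mulrDl.
  have /matrixP/(_ i1 j1) : block_mx 1%:M 0 0 0 + block_mx 0 0 0 1%:M
      = 1%:M :> 'M[R]_(n + n).
    by rewrite add_block_mx !addr0 add0r -scalar_mx_block.
  rewrite mxE => ->.
  rewrite !mxE (can_eq (@mxtens_indexK _ _)) xpair_eqE.
  by case: (i1 == j1); rewrite ?mul1r ?mul0r.
have /mulmx1_unit[Pu _] := PP.
by rewrite -[LHS]mulmx1 -PP mulKmx.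
Qed.

(** An index with first component [lshift n a] lies in a [Jmx] block. Conjugation by its corner
    [- Omega] cancels the sign and undoes the reversal in [torus_mx e], so the lower half carries
    the inverses of [e] in the original order. *)
Lemma rho_Sp_diag (d : 'rV[R]_n) (e : 'rV[R]_m) (a : 'I_n) (b : 'I_(m + m)) :
  let j := mxtens_index (lshift n a, b) in
  rho_Sp ((torus_mx d, torus_mx e) : amb (sprod (Sp F n) (Sp F m)) R) j j
  = d 0 a * match split b with inl b1 => e 0 b1 | inr b2 => (e 0 b2)^-1 end.
Proof.
rewrite /= /rho_Sp invmx_Pmx /=.
rewrite !(mulmxDl, mulmxDr) !tensmx_mul !mulmx_block.
rewrite !(mulmx0, mul0mx, add0r, addr0, mul1mx, mulmx1) block_mx0.
rewrite !tens0mx addr0 add0r mxE !tensmxE !(block_mxEul _ _ _ _ a a).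
rewrite [X in _ + X * _]mxE mul0r addr0.
rewrite [diag_mx d a a]mxE eqxx mulr1n; congr (_ * _); case: splitP => c def_b.
  rewrite (_ : b = lshift m c); last exact: val_inj.
  by rewrite block_mxEul mxE eqxx.
rewrite (_ : b = rshift m c); last exact: val_inj.
by rewrite block_mxEdr mulNmx mulmxN mulNmx opprK Omega_mulmx_Omega !mxE eqxx
  rev_ordK.
Qed.

End KroneckerDiagonal.

End Torus.

Section Coordinates.

Variable F : fieldType.

(** * Uniqueness of the coordinates of a character *)

Section Uniqueness.

Variables p q : nat.
Let G := sprod (Sp F p) (Sp F q).

(** At such a point a product of powers of the [charf j] collapses to a power of [ratfun_X], whose
    exponent is the one at [i]. *)
Lemma torus_coordinate (i : 'I_(rank G)) :
  exists2 t : amb G (ratfun_alg F), torus t &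
    forall j, charf j t = if j == i then ratfun_X F else 1.
Proof.
pose d (j : 'I_(p + q)) : ratfun_alg F := if j == i then ratfun_X F else 1.
have d_unit j : d j \is a GRing.unit.
  by rewrite /d; case: ifP => _; [exact: ratfun_X_unit | exact: unitr1].
exists (torus_mx (\row_j d (lshift q j)), torus_mx (\row_j d (rshift p j))).
  by split; apply: torus_mx_torus => j; rewrite mxE.
move=> j; rewrite -/(d j) [LHS]/=; case: splitP => k def_j.
  have -> : j = lshift q k by exact: val_inj.
  by rewrite block_mxEul !mxE eqxx.
have -> : j = rshift p k by exact: val_inj.
by rewrite block_mxEul !mxE eqxx.
Qed.

Lemma has_coords_uniq (chi : forall R : comUnitAlgType F, amb G R -> R) v w :
  has_coords chi v -> has_coords chi w -> v = w.
Proof.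
move=> [k [a [k_gt0 va chia]]] [l [b [l_gt0 wb chib]]]; apply/rowP => i.
have [t torus_t t_i] := torus_coordinate i.
have prod_t (c : 'I_(rank G) -> int) : \prod_j charf j t ^ c j = ratfun_X F ^ c i.
  rewrite (bigD1 i) // big1 => [|j ne_ji]; rewrite t_i.
    by rewrite eqxx; apply: mulr1.
  by rewrite (negPf ne_ji) exp1rz.
(* The two descriptions may have different denominators [k] and [l]; the power [k * l] of [chi]
   compares them and yields [a i * l = b i * k]. *)
have: chi _ t ^+ k ^+ l = chi _ t ^+ l ^+ k by rewrite -!exprM mulnC.
rewrite (chia _ _ torus_t) (chib _ _ torus_t) !prod_t !exprnP !exprz_exp.
move/ratfun_Xz_inj => eq_ab.
have kl_neq0 : (k * l)%:R != 0 :> rat.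
  by rewrite Num.Theory.pnatr_eq0 -lt0n muln_gt0 k_gt0.
apply: (mulIf kl_neq0); rewrite !mulr_natr mulrnA va mulnC mulrnA wb.
have eqMn_ab : a i *+ l = b i *+ k by rewrite -[LHS]mulr_natr -[RHS]mulr_natr !natz.
by rewrite -[LHS](rmorphMn intr) -[RHS](rmorphMn intr) eqMn_ab.
Qed.

(** The choice made by [epsilon] in [coords] is harmless because coordinates are unique. *)
Lemma coords_eq (chi : forall R : comUnitAlgType F, amb G R -> R) v :
  has_coords chi v -> coords chi = v.
Proof.
move=> chi_v; apply: has_coords_uniq (chi_v).
by apply: epsilon_spec; exists v.
Qed.

End Uniqueness.

(** * Linear forms and split indices *)

Lemma linform_delta (r : nat) (i : 'I_r) : linform (delta_mx 0 i) = 'X_i.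
Proof.
rewrite /linform (bigD1 i) //= big1 => [|j ne_ji]; rewrite mxE eqxx /=.
  by rewrite eqxx scale1r addr0.
by rewrite (negPf ne_ji) scale0r.
Qed.

Lemma linformD (r : nat) (v w : 'rV[rat]_r) : linform (v + w) = linform v + linform w.
Proof. by rewrite -big_split; apply: eq_bigr => i _; rewrite mxE scalerDl. Qed.

Lemma linformN (r : nat) (v : 'rV[rat]_r) : linform (- v) = - linform v.
Proof. by rewrite -sumrN; apply: eq_bigr => i _; rewrite mxE scaleNr. Qed.

Lemma split_lshift (r k : nat) (i : 'I_r) : split (lshift k i) = inl i.
Proof. exact: (unsplitK (inl i)). Qed.

Lemma split_rshift (r k : nat) (i : 'I_k) : split (rshift r i) = inr i.
Proof. exact: (unsplitK (inr i)). Qed.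

Lemma prod_exprz_delta (R : comUnitRingType) (r : nat) (f : 'I_r -> R) i :
  \prod_j f j ^ ((j == i)%:Z) = f i.
Proof.
rewrite (bigD1 i) //= eqxx expr1z big1 ?mulr1 // => j ne_ji.
by rewrite (negPf ne_ji) expr0z.
Qed.

(** * Pullbacks of the spin characters as weights of the tensor product *)

Section KroneckerPullback.

Variables n m : nat.
Let G := sprod (Sp F n) (Sp F m).
Let H := Spin F ((n + n) * (m + m)).
Variables (phi : ghom G H) (hphi : is_phi_Sp phi).

Definition kron_weight (a : 'I_n) (b : 'I_(m + m)) : 'rV[rat]_(rank G) :=
  delta_mx 0 (lshift m a) +
  match split b with
  | inl b1 => delta_mx 0 (rshift n b1)
  | inr b2 => - delta_mx 0 (rshift n b2)
  end.

(** The characters of [Spin] are read on the cover, so [hphi] turns the pullback into a diagonal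
    entry of [rho_Sp]. *)
Lemma coords_pullback (i : 'I_(rank H)) a b :
  widen_ord (half_le _) i = mxtens_index (lshift n a, b) ->
  coords (pullback phi (charf i)) = kron_weight a b.
Proof.
move=> def_i; apply: coords_eq.
pose c (j : 'I_(n + m)) : int := match split j with
  | inl j1 => (j1 == a)%:Z
  | inr j2 => match split b with inl b1 => (j2 == b1)%:Z | inr b2 => - (j2 == b2)%:Z end
  end.
(* The weight is already integral, so the denominator is [1] and [c] lists its entries as
   integers. *)
exists 1%N, c; split=> // [j|R t torus_t].
  rewrite mulr1n /kron_weight /c -[j]splitK.
  case: (split j) => j1; rewrite /= ?split_lshift ?split_rshift;
    case: (split b) => b1; rewrite !mxE /= ?eq_lshift ?eq_rshift ?eq_lrshift ?eq_rlshift;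
    by rewrite ?add0r ?addr0 ?subr0 // ?intrN.
have mem_t : Defs.mem t by case: torus_t => -[? _] [].
rewrite expr1 /pullback [LHS]/= hphi // def_i.
case: t torus_t {mem_t} => A B [/= torusA torusB].
have [d ->] := torusP torusA; have [e ->] := torusP torusB.
rewrite rho_Sp_diag big_split_ord /=.
congr (_ * _).
  rewrite -[LHS](prod_exprz_delta (fun j => d 0 j)); apply: eq_bigr => j _.
  by rewrite /c split_lshift block_mxEul mxE eqxx.
case def_b: (split b) => [b1|b2].
  rewrite -[LHS](prod_exprz_delta (fun j => e 0 j)); apply: eq_bigr => j _.
  by rewrite /c split_rshift def_b block_mxEul mxE eqxx.
(* The sign of the exponent is absorbed by taking the inverses as base. *)
rewrite -[LHS](prod_exprz_delta (fun j => (e 0 j)^-1)); apply: eq_bigr => j _.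
by rewrite /c split_rshift def_b block_mxEul mxE eqxx; case: (j == b2).
Qed.

Lemma linform_kron_weight a b : linform (kron_weight a b) =
  'X_(lshift m a) +
    match split b with inl b1 => 'X_(rshift n b1) | inr b2 => - 'X_(rshift n b2) end.
Proof.
by rewrite linformD; case: (split b) => c; rewrite ?linformN !linform_delta.
Qed.

Lemma half_dim : ((n + n) * (m + m))./2 = (n * (m + m))%N.
Proof. by rewrite mulnDl addnn doubleK. Qed.

(* The first half of the coordinates are those of the J blocks; the K blocks
   carry the inverse characters. *)
Definition kron_index (ab : 'I_n * 'I_(m + m)) : 'I_(rank H) :=
  cast_ord (esym half_dim) (mxtens_index ab).

Lemma kron_index_bij : bijective kron_index.
Proof.
exists (fun i => mxtens_unindex (cast_ord half_dim i)) => i; rewrite /kron_index.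
  by rewrite cast_ordKV mxtens_indexK.
by rewrite mxtens_unindexK cast_ordK.
Qed.

Lemma linform_coords_pullback a b :
  linform (coords (pullback phi (charf (kron_index (a, b))))) =
  'X_(lshift m a) +
    match split b with inl b1 => 'X_(rshift n b1) | inr b2 => - 'X_(rshift n b2) end.
Proof.
by rewrite (@coords_pullback _ a b) ?linform_kron_weight //; apply: val_inj.
Qed.

End KroneckerPullback.

(** * Evaluation of the quadratic form *)

Lemma comp_mpoly_sum_sqr (r k : nat) (f : 'I_r -> {mpoly rat[k]}) :
  comp_mpoly [tuple f i | i < r] (\sum_i 'X_i ^+ 2) = \sum_i f i ^+ 2.
Proof.
rewrite raddf_sum /=; apply: eq_bigr => i _.
by rewrite rmorphXn /= comp_mpolyXU -tnth_nth tnth_mktuple.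
Qed.

End Coordinates.

Theorem proposition10 (F : fieldType) (hF : 2%N \notin [pchar F])
    (n m : nat) (hn : (1 <= n)%N) (hm : (1 <= m)%N)
    (phi : ghom (sprod (Sp F n) (Sp F m)) (Spin F ((n + n) * (m + m))))
    (hphi : is_phi_Sp phi) :
  dagger phi (q_Spin F ((n + n) * (m + m)))
  = S2pair (m%:R *: q_Sp F n, n%:R *: q_Sp F m).
Proof.
rewrite /dagger /q_Spin /S2pair /q_Sp !comp_mpolyZ !comp_mpoly_sum_sqr.
rewrite (reindex (@kron_index F n m)); last exact/onW_bij/kron_index_bij.
pose x (a : 'I_n) : {mpoly rat[n + m]} := 'X_(lshift m a).
pose y (b : 'I_m) : {mpoly rat[n + m]} := 'X_(rshift n b).
transitivity (2%:R^-1 *: \sum_a \sum_b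
    linform (coords (pullback phi (charf (kron_index F (a, b))))) ^+ 2).
  by rewrite pair_bigA; congr (_ *: _); apply: eq_bigr => -[].
(* The index in ['I_(m + m)] is split into halves, pairing the weights with [+ y b] and [- y b]; [b]
   now ranges over ['I_m]. *)
transitivity (2%:R^-1 *: \sum_a \sum_b 2%:R *: (x a ^+ 2 + y b ^+ 2)).
  congr (_ *: _); apply: eq_bigr => a _; rewrite big_split_ord /= -big_split /=.
  apply: eq_bigr => b _; rewrite !linform_coords_pullback //.
  rewrite split_lshift split_rshift -/(x a) -/(y b) scaler_nat /=.
  by ring.
(* Each [x a ^+ 2] is counted once for every [b], giving the factor [m]; summing over [a] then
   counts each [y b ^+ 2] [n] times. The remaining [2] cancels the one half in [q_Spin]. *)
under eq_bigr => a _ do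
  rewrite -scaler_sumr big_split /= sumr_const card_ord.
rewrite -scaler_sumr scalerA mulVf // scale1r big_split /= sumr_const card_ord.
by rewrite !scaler_nat !sumrMnl.
Qed.
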